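(* Let $P$ be an infinite set of primes and let $k\in\mathbb{N}=\{1,2,\dots\}$. Let $(p_n)_{n\ge 1}$ be the strictly increasing sequence with underlying set $P$, and let $M_{P,k}$ be the additive submonoid of $\mathbb{Q}_{\ge 0}$ generated by the set \[ \Big\{ \frac{1}{p_j p_{j+2}\cdots p_{j+2k}} : j\in\mathbb{N}\Big\}. \] Then $M_{P,k}$ is an MCD monoid.
   Context: For an additive submonoid $M$ of $\mathbb{Q}_{\ge 0}$ and $a,b\in M$, write $b\mid_M a$ ($b$ divides $a$) if $a-b\in M$. For a nonempty finite subset $S$ of $M$, a common divisor $d\in M$ of $S$ (i.e. $d\mid_M s$ for all $s\in S$) is a maximal common divisor (MCD) of $S$ if the only common divisor of $\{s-d : s\in S\}$ in $M$ is $0$ (the only unit of $M$). $M$ is an MCD monoid if every nonempty finite subset of $M$ has an MCD. The generator $\frac{1}{p_j p_{j+2}\cdots p_{j+2k}}$ has denominator $\prod_{i=0}^{k} p_{j+2i}$. *)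

(* Defs.v *)
From mathcomp Require Import all_boot all_order all_algebra.
From mathcomp Require Import boolp classical_sets cardinality.

Set Implicit Arguments.
Unset Strict Implicit.
Unset Printing Implicit Defensive.

Import Order.TTheory GRing.Theory Num.Theory.

Local Open Scope classical_set_scope.
Local Open Scope ring_scope.

Definition additive_submonoid (M : set rat) : Prop :=
  [/\ M `<=` [set x | 0 <= x], M 0 & forall x y, M x -> M y -> M (x + y)].

(* [smallest C G] is the intersection of all sets that satisfy [C] and contain
   [G].  It is a junk value (the full set) when no submonoid of the nonnegative
   rationals contains [G], that is, when [G] has a negative element. *)
Definition generated_submonoid (G : set rat) : set rat :=
  smallest additive_submonoid G.

Lemma generated_submonoidP (G : set rat) :
  G `<=` [set x | 0 <= x] -> additive_submonoid (generated_submonoid G).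
Proof.
move=> G_ge0; split=> [x|M [[_ M0 _] _] //|x y Mx My M MG].
- by apply; split=> //; split=> //= u v; exact: addr_ge0.
- by case: (MG) => -[_ _ addM] _; apply: addM; [exact: Mx|exact: My].
Qed.

Definition divides (M : set rat) (b a : rat) : Prop := M (a - b).

Definition common_divisor (M S : set rat) (d : rat) : Prop :=
  M d /\ forall s, S s -> divides M d s.

Definition maximal_common_divisor (M S : set rat) (d : rat) : Prop :=
  common_divisor M S d /\
  forall e, common_divisor M [set s - d | s in S] e -> e = 0.

Definition MCD_monoid (M : set rat) : Prop :=
  additive_submonoid M /\
  forall S : set rat, S `<=` M -> finite_set S -> S !=set0 ->
    exists d, maximal_common_divisor M S d.

(* Sequences are indexed from 0: [p n] is the (n+1)-st element of [P]. *)
Definition increasing_enumeration (P : set nat) (p : nat -> nat) : Prop :=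
  {homo p : m n / (m < n)%N} /\ range p = P.

Definition generator (p : nat -> nat) (k j : nat) : rat :=
  (\prod_(i < k.+1) (p (j + 2 * i)%N)%:R)^-1.

Definition monoid_M (p : nat -> nat) (k : nat) : set rat :=
  generated_submonoid (range (generator p k)).

(* Main.v *)
(* Write [g_j] for [generator p k j].  All elements of a finite set [S] lie in
   [(1/D) Z], where [D] involves only the primes [p_0], ..., [p_(N+2k-1)].  Let
   [d] be the largest common divisor of [S] in [(1/D) Z].  If the [s - d] had
   a nonzero common divisor, they would all be divisible by a single [g_j].
   For [j < N] this [g_j] lies in [(1/D) Z], against the choice of [d].
   Otherwise, the generator [g_L] of largest index in a factorization of
   [s - d] is the only one whose denominator contains [p_(L+2k)]; so, if
   [L >= N], this prime divides its multiplicity and all copies of [g_L] can be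
   traded through [p_(L+2k) g_L = p_(L-2) g_(L-2)].  Trading down preserves the
   parity of indices, so all [s - d] are divisible by the same [p_i g_i], with
   [i] in [{N-2, N-1}] congruent to [j] modulo 2, again against the choice
   of [d]. *)
Require Import Defs.
From mathcomp Require Import all_boot all_order all_algebra.
From mathcomp Require Import archimedean zify ring.
From mathcomp Require Import boolp classical_sets cardinality.

Import Order.TTheory GRing.Theory Num.Theory.

Local Open Scope ring_scope.
Local Open Scope classical_set_scope.

(** * Generators and factorizations *)

Lemma generator_denominator_gt0 (p : nat -> nat) (k j : nat) :
  (forall i, prime (p i)) -> (0 < \prod_(i < k.+1) p (j + 2 * i))%N.
Proof. by move=> p_prime; apply: prodn_gt0 => i; apply: prime_gt0. Qed.

Lemma generatorE (p : nat -> nat) (k j : nat) :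
  generator p k j = ((\prod_(i < k.+1) p (j + 2 * i))%N%:R)^-1.
Proof. by rewrite /generator natr_prod. Qed.

Lemma generator_gt0 (p : nat -> nat) (k j : nat) :
  (forall i, prime (p i)) -> 0 < generator p k j.
Proof.
by move=> p_prime; rewrite generatorE invr_gt0 ltr0n generator_denominator_gt0.
Qed.

(** Both sides cancel to the inverse of the product of the [k] primes that the two denominators
    share. *)
Lemma generator_add2 (p : nat -> nat) (k j : nat) :
  (forall i, prime (p i)) ->
  (p (j + 2 + 2 * k)%N)%:R * generator p k (j + 2) =
  (p j)%:R * generator p k j.
Proof.
move=> p_prime.
have p_neq0 i : (p i)%:R != 0 :> rat by rewrite pnatr_eq0 -lt0n prime_gt0.
rewrite /generator big_ord_recr [in RHS]big_ord_recl /= muln0 addn0.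
rewrite !invfM mulrCA divff ?mulr1 // mulrA divff ?mul1r //.
congr _^-1; apply: eq_bigr => i _; congr (p _)%:R.
by rewrite /bump; lia.
Qed.

Lemma monoid_M_submonoid (p : nat -> nat) (k : nat) :
  (forall i, prime (p i)) -> additive_submonoid (monoid_M p k).
Proof.
move=> p_prime; apply: generated_submonoidP => _ [j _ <-] /=.
exact/ltW/generator_gt0.
Qed.

Lemma monoid_M_sum (p : nat -> nat) (k : nat) (x : rat) :
  (forall i, prime (p i)) ->
  monoid_M p k x <-> exists s, x = \sum_(j <- s) generator p k j.
Proof.
move=> p_prime; split=> [|[s ->]].
  move/(_ [set y | exists s, y = \sum_(j <- s) generator p k j]); apply.
  split=> [|_ [j _ <-]]; last by exists [:: j]; rewrite big_seq1.
  split=> [_ [s ->] /=||_ _ [s ->] [s' ->]].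
  - by apply: sumr_ge0 => j _; apply/ltW/generator_gt0.
  - by exists [::]; rewrite big_nil.
  - by exists (s ++ s'); rewrite big_cat.
have [_ M0 MD] := monoid_M_submonoid p k p_prime.
elim: s => [|j s IH]; first by rewrite big_nil.
rewrite big_cons; apply: MD => // A [_]; apply.
by exists j.
Qed.

(** * Common denominators *)

(** With exponent [k.+1], each of the [k.+1] primes in the denominator of a generator is absorbed by
    its own copy of the product. *)
Definition common_denominator (p : nat -> nat) (k B : nat) : nat :=
  (\prod_(i < B) p i) ^ k.+1.

Lemma common_denominator_gt0 (p : nat -> nat) (k B : nat) :
  (forall i, prime (p i)) -> (0 < common_denominator p k B)%N.
Proof.
move=> p_prime; rewrite expn_gt0 prodn_gt0 // => i; exact: prime_gt0.
Qed.

Lemma dvdn_common_denominator (p : nat -> nat) (k B C : nat) :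
  (B <= C)%N -> (common_denominator p k B %| common_denominator p k C)%N.
Proof.
move=> leBC; apply: dvdn_exp2r.
rewrite -!(big_mkord xpredT p) (big_cat_nat (leq0n B) leBC) /=.
exact: dvdn_mulr.
Qed.

Lemma dvdn_prod_exp (m n : nat) (F : 'I_n -> nat) :
  (forall i, F i %| m)%N -> (\prod_i F i %| m ^ n)%N.
Proof.
move=> Fm; rewrite -[X in (m ^ X)%N](card_ord n) -prod_nat_const.
elim/big_ind2: _ => // x y z w; exact: dvdn_mul.
Qed.

Lemma int_natMr_dvd (m n : nat) (x : rat) :
  (m %| n)%N -> m%:R * x \is a Num.int -> n%:R * x \is a Num.int.
Proof. by case/dvdnP=> r -> mx; rewrite natrM -mulrA rpredM // natr_int. Qed.

Lemma common_denominator_generator (p : nat -> nat) (k B j : nat) :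
  (forall i, prime (p i)) -> (j + 2 * k < B)%N ->
  (common_denominator p k B)%:R * generator p k j \is a Num.int.
Proof.
move=> p_prime jB; rewrite generatorE.
apply: (@int_natMr_dvd (\prod_(i < k.+1) p (j + 2 * i))); last first.
  by rewrite divff // pnatr_eq0 -lt0n generator_denominator_gt0.
apply: dvdn_prod_exp => i.
have iB : (j + 2 * i < B)%N by have := ltn_ord i; lia.
by rewrite (bigD1 (Ordinal iB)) //= dvdn_mulr.
Qed.

Lemma coprime_common_denominator (p : nat -> nat) (k B : nat) :
  (forall i, prime (p i)) -> injective p ->
  coprime (p B) (common_denominator p k B).
Proof.
move=> p_prime p_inj; apply: coprimeXr.
elim/big_ind: _ => [|m n|i _]; first exact: coprimen1.
  by rewrite coprimeMr => -> ->.
rewrite prime_coprime // dvdn_prime2 //; apply/eqP => /p_inj.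
by have := ltn_ord i; lia.
Qed.

(** * Trading down the generator of largest index *)

Lemma sum_filter_count (R : pzSemiRingType) (F : nat -> R) (L : nat)
    (s : seq nat) :
  \sum_(j <- s) F j =
  \sum_(j <- [seq x <- s | x != L]) F j + (count_mem L s)%:R * F L.
Proof.
rewrite (bigID (xpredC1 L)) /= big_filter; congr (_ + _).
under eq_bigl do rewrite negbK.
rewrite (eq_bigr (fun=> F L)); last by move=> i /eqP->.
by rewrite big_const_seq iter_addr_0 mulr_natl.
Qed.

Lemma sum_cat_nseq (R : pzSemiRingType) (F : nat -> R) (s : seq nat)
    (n j : nat) :
  \sum_(l <- s ++ nseq n j) F l = \sum_(l <- s) F l + n%:R * F j.
Proof. by rewrite big_cat big_nseq iter_addr_0 mulr_natl. Qed.

(** Once [N] is enlarged to [L] in the denominator, all terms of index below [L] become integers,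
    hence so do the copies of [generator p k L] together. So [p (L + 2 * k)] divides the denominator
    times the multiplicity, and it is coprime to the former. *)
Lemma dvdn_count_top (p : nat -> nat) (k N L : nat) (s : seq nat) :
  (forall i, prime (p i)) -> injective p -> (N <= L)%N ->
  all (fun j => j <= L)%N s ->
  (common_denominator p k (N + 2 * k))%:R * (\sum_(j <- s) generator p k j)
    \is a Num.int ->
  (p (L + 2 * k) %| count_mem L s)%N.
Proof.
move=> p_prime p_inj leNL s_le /int_natMr_dvd.
move/(_ (common_denominator p k (L + 2 * k))).
move/(_ (dvdn_common_denominator _ _ _ _ _)); rewrite leq_add2r => /(_ leNL).
set D := common_denominator _ _ _; rewrite (sum_filter_count _ _ L) mulrDr rpredDl.
  rewrite mulrA -natrM => /intrP[z Hz].
  have : ((D * count_mem L s)%N%:R : rat) =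
         z%:~R * (\prod_(i < k.+1) p (L + 2 * i))%N%:R.
    rewrite -Hz generatorE divfK //.
    by rewrite pnatr_eq0 -lt0n generator_denominator_gt0.
  rewrite !pmulrn -intrM => /intr_inj /(congr1 absz).
  rewrite abszM !absz_nat => E.
  rewrite -(@Gauss_dvdr _ D); last exact: coprime_common_denominator.
  by rewrite E big_ord_recr /= mulnA dvdn_mull.
rewrite mulr_sumr big_seq; apply: rpred_sum => j.
rewrite mem_filter => /andP[jL js].
apply: common_denominator_generator => //.
by have := allP s_le j js; lia.
Qed.

(** Induction on a strict bound [L] for the indices of a factorization of [t] that contains [j];
    each round trades away all copies of the top index. *)
Lemma divides_trade_down (p : nat -> nat) (k N i j : nat) (t : rat) :
  (forall i, prime (p i)) -> injective p ->
  (i < N <= i + 2)%N -> (N <= j)%N -> odd i = odd j ->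
  (common_denominator p k (N + 2 * k))%:R * t \is a Num.int ->
  divides (monoid_M p k) (generator p k j) t ->
  divides (monoid_M p k) ((p i)%:R * generator p k i) t.
Proof.
move=> p_prime p_inj /andP[iN Ni] Nj ij tD.
move=> /(monoid_M_sum _ _ _ p_prime)[s0 /eqP]; rewrite subr_eq addrC => /eqP tE.
have {s0 tE} [s [tE js]] :
    exists s, t = \sum_(l <- s) generator p k l /\ j \in s.
  by exists (j :: s0); rewrite big_cons mem_head.
have [L sL] : exists L, all (fun l => l < L)%N s.
  exists (\max_(l <- s) l).+1; apply/allP => l ls; rewrite ltnS.
  exact: leq_bigmax_seq.
elim: L => [|L IH] in s j Nj ij tE js sL *; first by have := allP sL j js.
have jL := allP sL j js.
have NL : (N <= L)%N by lia.
(* Since [i < j] have equal parity, [L >= j >= i + 2], so the subtraction does not truncate. *)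
have L2 : (L = L - 2 + 2)%N by lia.
have /dvdnP[m mE] : (p (L + 2 * k) %| count_mem L s)%N.
  by apply: dvdn_count_top NL sL _ => //; rewrite -tE.
have {}tE : t = \sum_(l <- [seq x <- s | x != L]) generator p k l +
    m%:R * ((p (L - 2)%N)%:R * generator p k (L - 2)).
  by rewrite -generator_add2 // -L2 mulrA -natrM -mE -sum_filter_count.
set s' := [seq x <- s | x != L] in tE.
(* Used with [n = m] to rewrite [t], and with [m.-1] to split off one batch at the end. *)
have sum_trade n : \sum_(l <- s' ++ nseq (n * p (L - 2)%N) (L - 2)%N)
    generator p k l = \sum_(l <- s') generator p k l +
      n%:R * ((p (L - 2)%N)%:R * generator p k (L - 2)).
  by rewrite sum_cat_nseq natrM mulrA.
have trade_lt : all (fun l => l < L)%N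
    (s' ++ nseq (m * p (L - 2)%N) (L - 2)%N).
  rewrite all_cat all_nseq all_filter; apply/andP; split; last by lia.
  by apply/allP => l /(allP sL) ?; apply/implyP; lia.
(* If [j] is not the top index, it survives the trade; otherwise [L - 2] takes its place, until it
   falls below [N]. *)
have [jEL|jNL] := eqVneq j L; last first.
  apply: (IH (s' ++ _) j _ _ _ _ trade_lt) => //; first by rewrite sum_trade.
  by rewrite mem_cat mem_filter jNL js.
have m_gt0 : (0 < m)%N.
  by move: js; rewrite jEL -has_pred1 has_count mE; case: (m).
have [NL2|L2N] := leqP N (L - 2).
  apply: (IH (s' ++ _) (L - 2)%N _ _ _ _ trade_lt) => //; first by lia.
    by rewrite sum_trade.
  by rewrite mem_cat mem_nseq eqxx muln_gt0 m_gt0 prime_gt0 // orbT.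
(* Both lie in [{N - 2, N - 1}] and have the same parity. *)
have -> : i = (L - 2)%N by lia.
apply/(monoid_M_sum _ _ _ p_prime).
exists (s' ++ nseq (m.-1 * p (L - 2)%N) (L - 2)%N).
rewrite sum_trade tE -addrA; congr (_ + _).
by rewrite -{1}(prednK m_gt0) mulrSr mulrDl mul1r addrK.
Qed.

(** * Existence of a maximal common divisor *)

Lemma finite_common_denominator (p : nat -> nat) (k : nat) (S : set rat) :
  (forall i, prime (p i)) -> S `<=` monoid_M p k -> finite_set S ->
  exists N, forall x, S x ->
    (common_denominator p k N)%:R * x \is a Num.int.
Proof.
move=> p_prime SM /finite_seqP[s sE]; rewrite {S}sE in SM *.
elim: s SM => [|x s IH] SM; first by exists 0%N.
have [y ys|N NE] := IH; first by apply: SM; rewrite /= inE ys orbT.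
have /(monoid_M_sum _ _ _ p_prime)[r ->] : monoid_M p k x.
  by apply: SM; rewrite /= mem_head.
exists (maxn N (\max_(l <- r) l + 2 * k).+1) => y.
rewrite /= inE => /predU1P[->|].
  rewrite mulr_sumr big_seq; apply: rpred_sum => j jr.
  apply: common_denominator_generator => //; rewrite leq_max ltnS leq_add2r.
  by rewrite leq_bigmax_seq ?orbT.
move=> /NE; apply: int_natMr_dvd; apply: dvdn_common_denominator.
exact: leq_maxl.
Qed.

Theorem proposition3p3 (P : set nat) (k : nat) (p : nat -> nat)
  (P_prime : P `<=` [set q | prime q]) (P_infinite : infinite_set P)
  (k_gt0 : (0 < k)%N) (p_enum : increasing_enumeration P p) :
  MCD_monoid (monoid_M p k).
Proof.
have [p_incr p_range] := p_enum.
have p_prime i : prime (p i) by apply: P_prime; rewrite -p_range; exists i.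
have p_inj : injective p.
  by move=> i j ijE; case: (ltngtP i j) => // /p_incr; rewrite ijE ltnn.
have M_sub := monoid_M_submonoid p k p_prime.
have [M_ge0 M0 MD] := M_sub.
split=> // S SM S_fin [s1 Ss1].
have [N0 N0S] := finite_common_denominator p k S p_prime SM S_fin.
(* The shift by 2 makes [N - 2] and [N - 1] genuine indices, namely [N0] and [N0.+1]. *)
pose N := N0.+2; pose D := common_denominator p k (N + 2 * k).
have SD x : S x -> D%:R * x \is a Num.int.
  by move=> /N0S; apply: int_natMr_dvd; apply: dvdn_common_denominator; lia.
have D_gt0 : 0 < D%:R :> rat by rewrite ltr0n common_denominator_gt0.
have D_neq0 := lt0r_neq0 D_gt0.
(* Common divisors in (1/D)Z are recorded by their numerators, which are bounded because such a
   divisor is at most [s1]. *)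
pose Q n := `[< common_divisor (monoid_M p k) S (n%:R / D%:R) >].
have Q_ex : exists n, Q n.
  exists 0%N; apply/asboolP; rewrite mul0r; split=> // s Ss.
  by rewrite /divides subr0; apply: SM.
have Q_le n : Q n -> (n <= Num.trunc (D%:R * s1))%N.
  move=> /asboolP[_ /(_ s1 Ss1) /M_ge0] /=.
  rewrite subr_ge0 ler_pdivrMr // => ns.
  rewrite truncn_ge_nat; first by rewrite mulrC.
  exact: mulr_ge0 (ltW D_gt0) (M_ge0 _ (SM _ Ss1)).
have [n /asboolP Qn n_max] := ex_maxnP Q_ex Q_le.
set d := n%:R / D%:R in Qn.
(* Otherwise [d + e] would be a common divisor of [S] with a numerator above [n]. *)
have no_larger e : 0 < e -> D%:R * e \is a Num.int -> monoid_M p k e ->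
    ~ forall s, S s -> divides (monoid_M p k) e (s - d).
  move=> e_gt0 eD Me eS.
  have /natrP[m mE] : D%:R * e \is a Num.nat.
    by rewrite natrEint eD mulr_ge0 // ltW.
  have dE : d + e = (n + m)%:R / D%:R.
    by rewrite natrD mulrDl -mE mulrAC divff // mul1r.
  have /n_max : Q (n + m)%N.
    apply/asboolP; rewrite -dE; split; first by apply: MD => //; case: Qn.
    by move=> s /eS; rewrite /divides opprD addrA.
  rewrite -{2}[n]addn0 leq_add2l leqn0 => /eqP m0.
  by have := mulr_gt0 D_gt0 e_gt0; rewrite mE m0 ltxx.
exists d; split=> // e [Me eS].
have /(monoid_M_sum _ _ _ p_prime)[[|j s] eE] := Me.
  by rewrite eE big_nil.
exfalso.
have gS t : S t -> divides (monoid_M p k) (generator p k j) (t - d).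
  move=> St; have := eS (t - d) (imageP _ St); rewrite /divides => Mt.
  rewrite (_ : _ - _ = (t - d - e) + \sum_(l <- s) generator p k l); last first.
    by rewrite eE big_cons; ring.
  by apply: MD => //; apply/(monoid_M_sum _ _ _ p_prime); exists s.
have M_gen l : monoid_M p k (generator p k l).
  by apply/(monoid_M_sum _ _ _ p_prime); exists [:: l]; rewrite big_seq1.
have [Nj|jN] := leqP N j; last first.
  apply: (no_larger (generator p k j)) gS => //; first exact: generator_gt0.
  by apply: common_denominator_generator => //; lia.
have [i [iN ij]] : exists i, (i < N <= i + 2)%N /\ odd i = odd j.
  have [oddE|oddNE] := eqVneq (odd N0) (odd j).
    by exists N0; split=> //; rewrite /N; lia.
  by exists N0.+1; split; [rewrite /N; lia|move: oddNE => /=; do 2!case: odd].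
have pi_gt0 : (0 < p i)%N by apply: prime_gt0.
apply: (no_larger ((p i)%:R * generator p k i)).
- by rewrite mulr_gt0 ?ltr0n ?generator_gt0.
- rewrite mulrCA rpredM ?natr_int // common_denominator_generator //.
  by case/andP: iN; lia.
- apply/(monoid_M_sum _ _ _ p_prime); exists (nseq (p i) i).
  by rewrite big_nseq iter_addr_0 mulr_natl.
- move=> t St; apply: (@divides_trade_down p k N i j) => //; last exact: gS.
  rewrite mulrBr; apply: rpredB; first exact: SD.
  by rewrite /d mulrCA divff // mulr1 natr_int.
Qed.
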